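(* Let $(\mathfrak g,[\,,\,])$ be a unimodular real Lie algebra of dimension $n$ (that is, $\mathrm{trace}(\mathrm{ad}_\xi)=0$ for all $\xi\in\mathfrak g$) and consider on the dual space $\mathfrak g^*$ the Lie-Poisson structure. Then, for all $k$, $$H_k^{LJ}(\mathfrak g^* )\cong H_{LJ}^{n-k+1}(\mathfrak g^* ).$$
   Context: $\mathcal V^k(M)$ and $\Omega^k(M)$ denote the spaces of $k$-vectors and $k$-forms on a manifold $M$ (zero for $k<0$). $[\,,\,]$ on multivectors is the Schouten-Nijenhuis bracket, with the convention $[X,f]=X(f)$ for functions $f$, $[X,P]=\mathcal L_XP$ for vector fields $X$, $[P,Q]=(-1)^{pq}[Q,P]$ and $[P,Q\wedge R]=[P,Q]\wedge R+(-1)^{pq+q}Q\wedge[P,R]$ for $P\in\mathcal V^p(M)$, $Q\in\mathcal V^q(M)$. The Lie-Poisson bracket on $\mathfrak g^*$ is $\{f,g\}(x)=x([df(x),dg(x)])$, $x\in\mathfrak g^*$, with $df(x),dg(x)\in(\mathfrak g^* )^*\cong\mathfrak g$; its Poisson 2-vector is $\bar\Lambda=\frac12\sum_{i,j,k}c_{ij}^kx_k\frac{\partial}{\partial x_i}\wedge\frac{\partial}{\partial x_j}$, where $(x_i)$ are the linear coordinates on $\mathfrak g^*$ obtained from a basis of $\mathfrak g$ and $c_{ij}^k$ are the structure constants. For a Poisson manifold $(M,\Lambda)$ (regarded as a Jacobi manifold with $E=0$), the LJ-cohomology $H^*_{LJ}(M)$ is the cohomology of $(\mathcal V^*(M)\oplus\mathcal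 V^{*-1}(M),\sigma)$ with $\sigma(P,Q)=(-[\Lambda,P]+\Lambda\wedge Q,\ [\Lambda,Q])$. The LJ-homology $H_*^{LJ}(M)$ is the homology of $(\Omega^*(M)\oplus\Omega^{*-1}(M),\delta)$, where for $(\alpha,\beta)\in\Omega^k(M)\oplus\Omega^{k-1}(M)$ $$\delta(\alpha,\beta)=\big(i(\Lambda)d\alpha-d\,i(\Lambda)\alpha,\ i(\Lambda)d\beta-d\,i(\Lambda)\beta+(-1)^ki(\Lambda)\alpha\big),$$ with $i(X\wedge Y)\alpha=\alpha(X,Y,\cdot,\dots,\cdot)$. *)

(* Defs.v *)
From HB Require Import structures.
From mathcomp Require Import all_boot all_order all_algebra.
From mathcomp Require Import generic_quotient ring_quotient.
From mathcomp Require Import all_classical all_reals all_analysis.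
Import numFieldNormedType.Exports.

Set Implicit Arguments.
Unset Strict Implicit.
Unset Printing Implicit Defensive.

Import Order.TTheory GRing.Theory Num.Theory.
Local Open Scope ring_scope.

Definition lmod_iso (R : pzRingType) (U V : lmodType R) : Prop :=
  exists f : {linear U -> V}, bijective f.

Section QuotientModule.
Variables (R : pzRingType) (V : lmodType R) (B : submodClosed V).
Local Open Scope quotient_scope.

(* [B] again, with the [zmodClosed] instance expected by [Quotient.quot]. *)
Definition lquot_ker : {pred V} := fun v => v \in B.

Fact lquot_ker_closed : GRing.subsemimod_closed lquot_ker.
Proof. exact: GRing.subsemimodClosedP. Qed.

HB.instance Definition _ :=
  GRing.isSubmodClosed.Build R V lquot_ker lquot_ker_closed.

Definition lquot : Type := Quotient.quot lquot_ker.

HB.instance Definition _ := GRing.Zmodule.on lquot.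

Definition lquot_pi (v : V) : lquot := \pi_(Quotient.quot lquot_ker) v.

Definition lquot_scale (a : R) (q : lquot) : lquot :=
  lquot_pi (a *: repr (q : Quotient.quot lquot_ker)).

Lemma lquot_piP (q : lquot) : exists v, q = lquot_pi v.
Proof.
by exists (repr (q : Quotient.quot lquot_ker)); rewrite /lquot_pi reprK.
Qed.

Lemma eq_lquot_pi (u v : V) : lquot_pi u = lquot_pi v <-> u - v \in B.
Proof.
have -> : (u - v \in B) = (u - v \in lquot_ker) by [].
rewrite (Quotient.idealrBE lquot_ker); split; last by move/eqP.
by rewrite /lquot_pi => ->.
Qed.

Lemma lquot_piB (u v : V) : lquot_pi (u - v) = lquot_pi u - lquot_pi v.
Proof. exact: (raddfB (\pi_(Quotient.quot lquot_ker))). Qed.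

Lemma lquot_piD (u v : V) : lquot_pi (u + v) = lquot_pi u + lquot_pi v.
Proof. exact: (raddfD (\pi_(Quotient.quot lquot_ker))). Qed.

Lemma lquot_piZ (a : R) (v : V) : lquot_pi (a *: v) = lquot_scale a (lquot_pi v).
Proof.
apply/eq_lquot_pi; rewrite -scalerBr rpredZ //; apply/eq_lquot_pi.
by rewrite /lquot_pi reprK.
Qed.

Fact lquot_scaleA a b q :
  lquot_scale a (lquot_scale b q) = lquot_scale (a * b) q.
Proof. by have [v ->] := lquot_piP q; rewrite -!lquot_piZ scalerA. Qed.

Fact lquot_scale1 : left_id 1 lquot_scale.
Proof. by move=> q; have [v ->] := lquot_piP q; rewrite -lquot_piZ scale1r. Qed.

Fact lquot_scaleDr : right_distributive lquot_scale +%R.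
Proof.
move=> a p q; have [[u ->] [v ->]] := (lquot_piP p, lquot_piP q).
by rewrite -!lquot_piZ -!lquot_piD -lquot_piZ scalerDr.
Qed.

Fact lquot_scaleDl q : {morph lquot_scale^~ q : a b / a + b}.
Proof.
move=> a b; have [v ->] := lquot_piP q.
by rewrite -!lquot_piZ -lquot_piD scalerDl.
Qed.

HB.instance Definition _ := GRing.Zmodule_isLmodule.Build R lquot
  lquot_scaleA lquot_scale1 lquot_scaleDr lquot_scaleDl.

End QuotientModule.

Section Homology.
Variables (R : pzRingType) (W : lmodType R) (C C' : submodClosed W).
Variables (d d' : {linear W -> W}).

Definition is_cycle : {pred W} := [pred x | (x \in C) && (d x == 0)].

Fact is_cycle_closed : GRing.subsemimod_closed is_cycle.
Proof.
split=> [|a x]; first split=> [|x y].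
- by rewrite !inE rpred0 linear0 eqxx.
- rewrite !inE => /andP[Cx /eqP dx] /andP[Cy /eqP dy].
  by rewrite rpredD // linearD dx dy addr0 eqxx.
- by rewrite !inE => /andP[Cx /eqP dx]; rewrite rpredZ // linearZ /= dx scaler0 eqxx.
Qed.

HB.instance Definition _ :=
  GRing.isSubmodClosed.Build R W is_cycle is_cycle_closed.

Record cycle := Cycle {cycle_val : W; _ : cycle_val \in is_cycle}.

HB.instance Definition _ := [isSub for cycle_val].
HB.instance Definition _ := [Choice of cycle by <:].
HB.instance Definition _ := [SubChoice_isSubLmodule of cycle by <:].

Definition is_boundary : {pred cycle} :=
  fun z => `[< exists2 y, y \in C' & d' y = val z >].

Fact is_boundary_closed : GRing.subsemimod_closed is_boundary.
Proof.
split=> [|a z]; first split=> [|z t].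
- by apply/asboolP; exists 0; rewrite ?rpred0 // !linear0.
- move=> /asboolP[x Cx dx] /asboolP[y Cy dy]; apply/asboolP.
  by exists (x + y); rewrite ?rpredD // !linearD dx dy.
- move=> /asboolP[x Cx dx]; apply/asboolP.
  by exists (a *: x); rewrite ?rpredZ // !linearZ /= dx.
Qed.

HB.instance Definition _ :=
  GRing.isSubmodClosed.Build R cycle is_boundary is_boundary_closed.

(* The homology at C of C' --d'--> C --d--> W, i.e. ker d / (ker d :&: im d'),
   which is ker d / im d' when C' -> C -> W is a complex. *)
Definition homology : lmodType R := lquot is_boundary.

End Homology.

Section LieAlgebra.
Variables (R : realType) (g : vectType R) (br : g -> g -> g).

Record lie_bracket : Prop := LieBracket {
  lie_linearl : forall y, linear (br^~ y);
  lie_linearr : forall x, linear (br x);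
  lie_alternating : forall x, br x x = 0;
  lie_jacobi : forall x y z,
    br x (br y z) + br y (br z x) + br z (br x y) = 0
}.

Definition ad (x : g) : 'End(g) := linfun (br x).

Definition lfun_trace (f : 'End(g)) : R :=
  \tr (passmx.mxof (vbasis {:g}) (vbasis {:g}) f).

Definition unimodular : Prop := forall x, lfun_trace (ad x) = 0.

End LieAlgebra.

Definition dual (R : realType) (g : vectType R) := 'Hom(g, R^o).

Section Smooth.
Variables (R : realType) (g : vectType R) (n : nat) (e : n.-tuple g).
Implicit Types (f h : dual g -> R) (x : dual g) (i : 'I_n).

(* When [e] is a basis of [g], [dual_vect] is the dual basis, and [dual_pt]
   is the inverse of the linear chart x |-> (x e_i)_i of g^*. *)
Definition dual_vect (i : 'I_n) : dual g := linfun (coord e i : g -> R^o).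

Definition dual_pt (v : 'rV[R]_n) : dual g := \sum_i v 0 i *: dual_vect i.

Definition along i x f : R -> R := fun t => f (x + t *: dual_vect i).

Definition partial i f : dual g -> R := fun x => 'D_1 (along i x f) 0.

Fixpoint Ck (k : nat) f : Prop :=
  match k with
  | 0 => continuous (fun v => f (dual_pt v))
  | k'.+1 => continuous (fun v => f (dual_pt v)) /\
      forall i, (forall x, derivable (along i x f) 0 1) /\ Ck k' (partial i f)
  end.

Definition smooth : {pred dual g -> R} := fun f => `[< forall k, Ck k f >].

Lemma CkW k f : Ck k.+1 f -> Ck k f.
Proof.
elim: k f => [|k IH] f; first by case.
move=> [cf df]; split=> // i; split; first by case: (df i).
by apply: IH; case: (df i).
Qed.

Lemma Ck_cont k f : Ck k f -> continuous (fun v => f (dual_pt v)).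
Proof. by case: k => [|k] // []. Qed.

Lemma partialZD i a f h : (forall x, derivable (along i x f) 0 1) ->
  (forall x, derivable (along i x h) 0 1) ->
  partial i (a *: f + h) = a *: partial i f + partial i h.
Proof.
move=> df dh; apply/funext => x; rewrite /partial.
have -> : along i x (a *: f + h) = a *: along i x f + along i x h by [].
by rewrite deriveD ?deriveZ //; exact: derivableZ.
Qed.

Lemma partialM i f h : (forall x, derivable (along i x f) 0 1) ->
  (forall x, derivable (along i x h) 0 1) ->
  partial i (f * h) = f * partial i h + h * partial i f.
Proof.
move=> df dh; apply/funext => x; rewrite /partial.
have -> : along i x (f * h) = along i x f * along i x h by [].
by rewrite deriveM // /along scale0r addr0.
Qed.

Lemma CkZD k a f h : Ck k f -> Ck k h -> Ck k (a *: f + h).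
Proof.
elim: k f h => [|k IH] f h.
  by move=> cf ch v; exact: cvgD (cvgZl_tmp (cf v)) (ch v).
move=> [cf df] [ch dh]; split.
  by move=> v; exact: cvgD (cvgZl_tmp (cf v)) (ch v).
move=> i; have [[dif ckf] [dih ckh]] := (df i, dh i); split.
  by move=> x; exact: derivableD (derivableZ (dif x)) (dih x).
by rewrite partialZD //; exact: IH.
Qed.

Lemma CkM k f h : Ck k f -> Ck k h -> Ck k (f * h).
Proof.
elim: k f h => [|k IH] f h.
  by move=> cf ch v; exact: cvgM (cf v) (ch v).
move=> Cf Ch; have [[cf df] [ch dh]] := (Cf, Ch); split.
  by move=> v; exact: cvgM (cf v) (ch v).
move=> i; have [[dif ckf] [dih ckh]] := (df i, dh i); split.
  by move=> x; exact: derivableM (dif x) (dih x).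
rewrite partialM // -[f * _]scale1r.
by apply: CkZD; apply: IH => //; exact: CkW.
Qed.

Lemma Ck_cst k (c : R) : Ck k (cst c).
Proof.
elim: k c => [|k IH] c; first exact: cst_continuous.
split=> [|i]; first exact: cst_continuous.
split=> [x|]; first exact: derivable_cst.
have -> : partial i (cst c) = cst 0.
  by apply/funext => x; rewrite /partial [along _ _ _](_ : _ = cst c) // derive_cst.
exact: IH.
Qed.

Lemma smoothP f : reflect (forall k, Ck k f) (f \in smooth).
Proof. exact: asboolP. Qed.

Lemma smooth_derivable f : f \in smooth ->
  forall i x, derivable (along i x f) 0 1.
Proof. by move=> /smoothP/(_ 1%N)[_ df] i; case: (df i). Qed.

Fact smooth_subring : GRing.subring_closed smooth.
Proof.
split; first by apply/smoothP => k; exact: Ck_cst.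
- move=> f h /smoothP sf /smoothP sh; apply/smoothP => k.
  by rewrite addrC -scaleN1r; exact: CkZD.
- by move=> f h /smoothP sf /smoothP sh; apply/smoothP => k; exact: CkM.
Qed.

HB.instance Definition _ :=
  GRing.isSubringClosed.Build (dual g -> R) smooth smooth_subring.

Fact smooth_scaler : GRing.scaler_closed smooth.
Proof.
move=> a f /smoothP sf; apply/smoothP => k.
by rewrite -[_ *: _]addr0; apply: CkZD => //; exact: Ck_cst.
Qed.

Fact smooth_submod : GRing.subsemimod_closed smooth.
Proof.
by split; [split; [exact: rpred0|exact: rpredD]|exact: smooth_scaler].
Qed.

Record cinfty := Cinfty {cinfty_val :> dual g -> R; _ : cinfty_val \in smooth}.

HB.instance Definition _ := [isSub for cinfty_val].
HB.instance Definition _ := [Choice of cinfty by <:].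
HB.instance Definition _ := 
  GRing.SubChoice_isSubComPzRing.Build (dual g -> R) smooth cinfty
    smooth_subring.
HB.instance Definition _ := 
  GRing.SubZmodule_isSubLmodule.Build R (dual g -> R) smooth cinfty
    smooth_submod.

Lemma smooth_partial i f : f \in smooth -> partial i f \in smooth.
Proof. by move=> /smoothP sf; apply/smoothP => k; have [_ /(_ i)[]] := sf k.+1. Qed.

Definition cpartial i (f : cinfty) : cinfty :=
  Cinfty (smooth_partial i (valP f)).

Fact cpartial_linear i : linear (cpartial i).
Proof.
move=> a f h; apply: val_inj => /=.
by rewrite partialZD //; apply: smooth_derivable; exact: valP.
Qed.

HB.instance Definition _ i := GRing.isLinear.Build R cinfty cinfty *:%R
  (cpartial i) (cpartial_linear i).

(* For [x] in g^* and [u] in [g], the value x(u) is a linear function of x. *)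
Fact smooth_eval (u : g) : (fun x : dual g => x u : R) \in smooth.
Proof.
have cv : continuous (fun v => dual_pt v u : R).
  have -> : (fun w => dual_pt w u : R) =
      (fun w => \sum_i w 0 i * (dual_vect i u : R)).
    apply/funext => w; rewrite /dual_pt sum_lfunE; apply: eq_bigr => i _.
    by rewrite scale_lfunE.
  elim: (index_enum _) => [|i r IH].
    under eq_fun do rewrite big_nil.
    exact: cst_continuous.
  under eq_fun do rewrite big_cons.
  by move=> v; exact: cvgD (cvgMr_tmp (@coord_continuous _ _ _ 0 i v)) (IH v).
apply/smoothP => -[|k] //; split=> // i.
have al x : along i x (fun y : dual g => y u : R) =
    cst (x u : R) + (dual_vect i u : R) *: id.
  by apply/funext => t; rewrite /along add_lfunE scale_lfunE; congr (_ + _); exact: mulrC.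
have de x : derivable (cst (x u : R) + (dual_vect i u : R) *: id) (0 : R) 1.
  by apply: derivableD; [exact: derivable_cst|apply: derivableZ; exact: derivable_id].
split=> [x|]; first by rewrite al.
have -> : partial i (fun y : dual g => y u : R) = cst (dual_vect i u : R).
  apply/funext => x; rewrite /partial al.
  rewrite (deriveD (@derivable_cst _ _ _ _ _ _) (derivableZ (@derivable_id _ _ _ _))).
  rewrite derive_cst (deriveZ _ (@derivable_id _ _ _ _)) derive_id add0r.
  exact: mulr1.
exact: Ck_cst.
Qed.

Definition ceval (u : g) : cinfty := Cinfty (smooth_eval u).

End Smooth.

Section Calculus.
Variables (R : realType) (g : vectType R) (n : nat) (e : n.-tuple g).
Local Notation A := (cinfty e).

Fact cinfty_scaleAl (a : R) (f h : A) : a *: (f * h) = a *: f * h.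
Proof.
by apply: val_inj; apply/funext => x; exact: (mulrA a (f x : R) (h x)).
Qed.

Fact cinfty_scaleAr (a : R) (f h : A) : a *: (f * h) = f * (a *: h).
Proof. by rewrite mulrC cinfty_scaleAl mulrC. Qed.

(* A multivector field sum_S P_S d/dx_S, or a form sum_S P_S dx_S, is the
   family of its coefficients; for S = {s_1 < ... < s_p}, d/dx_S stands for
   d/dx_s1 /\ ... /\ d/dx_sp, and likewise for dx_S.  Elements of [ext] may be
   inhomogeneous. *)
Definition ext : Type := {ffun {set 'I_n} -> A}.

HB.instance Definition _ := GRing.Lmodule.on ext.

Implicit Types (P Q L : ext) (i j : 'I_n) (S T : {set 'I_n}) (k : int).

(* V^k or Omega^k, zero for k < 0 and for k > n. *)
Definition homog k : {pred ext} :=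
  fun P => [forall S, (P S != 0) ==> (#|S|%:Z == k)].

Definition fmul (f : A) P : ext := [ffun S : {set 'I_n} => f * P S].

(* d/dx_i or dx_i *)
Definition gen i : ext := [ffun S : {set 'I_n} => (S == [set i])%:R].

Definition inversions S T : nat :=
  #|[pred p : 'I_n * 'I_n | [&& p.1 \in S, p.2 \in T & (p.2 < p.1)%N]]|.

Definition wedge P Q : ext :=
  [ffun U : {set 'I_n} => \sum_(S in powerset U)
     (-1) ^+ inversions S (U :\: S) * (P S * Q (U :\: S))].

(* Contraction in the first slot, alpha |-> alpha(d/dx_i, ., ..., .) for forms
   and P |-> P(dx_i, ., ..., .) for multivector fields. *)
Definition contract i P : ext :=
  [ffun S : {set 'I_n} => if i \in S then 0
             else (-1) ^+ #|[pred j in S | (j < i)%N]| * P (i |: S)].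

Definition coef_partial i P : ext := [ffun S : {set 'I_n} => cpartial i (P S)].

Definition ext_d P : ext := \sum_i wedge (gen i) (coef_partial i P).

(* i(L) for a 2-vector L = sum_(i < j) L_ij d/dx_i /\ d/dx_j, by
   i(X /\ Y) alpha = alpha(X, Y, ., ..., .). *)
Definition contract2 L P : ext :=
  \sum_(i < n) \sum_(j < n | (i < j)%N)
     fmul (L [set i; j]) (contract j (contract i P)).

Definition grading P : ext := [ffun S : {set 'I_n} => (-1) ^+ #|S| * P S].

(* [P, .] is the graded derivation of degree p - 1 (for P of degree p) with
   [P, f] = sum_i (d f / d x_i) P(dx_i, ., ..., .) and
   [P, d/dx_i] = (-1)^p [d/dx_i, P] = (-1)^p (d P / d x_i). *)
Definition schouten P Q : ext :=
  \sum_i (wedge (contract i P) (coef_partial i Q)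
          + wedge (coef_partial i (grading P)) (contract i Q)).

Fact homog_closed k : GRing.subsemimod_closed (homog k).
Proof.
have H P : reflect (forall S, #|S|%:Z != k -> P S = 0) (P \in homog k).
  apply: (iffP forallP) => [hP S Sk|hP S].
    by apply/eqP; apply: contraNT Sk; exact/implyP.
  by apply/implyP; apply: contraNT => /hP/eqP.
split=> [|a P /H hP]; first split=> [|P Q /H hP /H hQ].
- by apply/H => S _; rewrite ffunE.
- by apply/H => S Sk; rewrite ffunE hP // hQ // addr0.
- by apply/H => S Sk; rewrite ffunE hP // scaler0.
Qed.

HB.instance Definition _ k :=
  GRing.isSubmodClosed.Build R ext (homog k) (homog_closed k).

Fact fmul_linear f : linear (fmul f).
Proof.
move=> a P Q; apply/ffunP => S; rewrite !ffunE mulrDr; congr (_ + _).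
by rewrite cinfty_scaleAr.
Qed.

Fact wedge_linear P : linear (wedge P).
Proof.
move=> a Q1 Q2; apply/ffunP => U; rewrite !ffunE scaler_sumr -big_split /=.
apply: eq_bigr => S _; rewrite !ffunE !mulrDr; congr (_ + _).
by rewrite !cinfty_scaleAr.
Qed.

Fact contract_linear i : linear (contract i).
Proof.
move=> a P Q; apply/ffunP => S; rewrite !ffunE; case: ifP => _.
  by rewrite scaler0 addr0.
by rewrite mulrDr; congr (_ + _); rewrite cinfty_scaleAr.
Qed.

Fact coef_partial_linear i : linear (coef_partial i).
Proof. by move=> a P Q; apply/ffunP => S; rewrite !ffunE linearP. Qed.

HB.instance Definition _ f :=
  GRing.isLinear.Build R ext ext *:%R (fmul f) (fmul_linear f).
HB.instance Definition _ P :=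
  GRing.isLinear.Build R ext ext *:%R (wedge P) (wedge_linear P).
HB.instance Definition _ i :=
  GRing.isLinear.Build R ext ext *:%R (contract i) (contract_linear i).
HB.instance Definition _ i :=
  GRing.isLinear.Build R ext ext *:%R (coef_partial i) (coef_partial_linear i).

Fact ext_d_linear : linear ext_d.
Proof.
move=> a P Q; rewrite /ext_d scaler_sumr -big_split /=.
by apply: eq_bigr => i _; rewrite !linearP.
Qed.

Fact contract2_linear L : linear (contract2 L).
Proof.
move=> a P Q; rewrite /contract2 scaler_sumr -big_split /=.
apply: eq_bigr => i _; rewrite scaler_sumr -big_split /=.
by apply: eq_bigr => j _; rewrite !linearP.
Qed.

Fact schouten_linear P : linear (schouten P).
Proof.
move=> a Q1 Q2; rewrite /schouten scaler_sumr -big_split /=.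
by apply: eq_bigr => i _; rewrite !linearP scalerDr addrACA.
Qed.

HB.instance Definition _ :=
  GRing.isLinear.Build R ext ext *:%R ext_d ext_d_linear.
HB.instance Definition _ L :=
  GRing.isLinear.Build R ext ext *:%R (contract2 L) (contract2_linear L).
HB.instance Definition _ P :=
  GRing.isLinear.Build R ext ext *:%R (schouten P) (schouten_linear P).

Variable Lambda : ext.

Definition LJ_chain k : {pred ext * ext} :=
  fun z => (z.1 \in homog k) && (z.2 \in homog (k - 1)).

Definition LJ_sigma (z : ext * ext) : ext * ext :=
  (- schouten Lambda z.1 + wedge Lambda z.2, schouten Lambda z.2).

Definition LJ_delta k (z : ext * ext) : ext * ext :=
  (contract2 Lambda (ext_d z.1) - ext_d (contract2 Lambda z.1),
   contract2 Lambda (ext_d z.2) - ext_d (contract2 Lambda z.2)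
     + ((-1) ^ k : R) *: contract2 Lambda z.1).

Fact LJ_chain_closed k : GRing.subsemimod_closed (LJ_chain k).
Proof.
split=> [|a z /andP[z1 z2]]; first split=> [|y z /andP[y1 y2] /andP[z1 z2]].
- by apply/andP; split; exact: rpred0.
- by apply/andP; split; exact: rpredD.
- by apply/andP; split; exact: rpredZ.
Qed.

HB.instance Definition _ k :=
  GRing.isSubmodClosed.Build R (ext * ext)%type (LJ_chain k)
    (LJ_chain_closed k).

Fact LJ_sigma_linear : linear LJ_sigma.
Proof.
move=> a y z; congr pair => /=; rewrite !linearP //=.
by rewrite scalerDr addrACA.
Qed.

HB.instance Definition _ :=
  GRing.isLinear.Build R (ext * ext)%type (ext * ext)%type *:%R
    LJ_sigma LJ_sigma_linear.

Fact LJ_delta_linear k : linear (LJ_delta k).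
Proof.
move=> a y z; congr pair => /=; rewrite !linearP /=.
  by rewrite scalerDr addrACA.
rewrite !scalerDr [in RHS]addrACA; congr (_ + _).
by rewrite addrACA.
Qed.

HB.instance Definition _ k :=
  GRing.isLinear.Build R (ext * ext)%type (ext * ext)%type *:%R
    (LJ_delta k) (LJ_delta_linear k).

Definition LJ_cohomology k : lmodType R :=
  homology (LJ_chain k) (LJ_chain (k - 1)) LJ_sigma LJ_sigma.

Definition LJ_homology k : lmodType R :=
  homology (LJ_chain k) (LJ_chain (k + 1)) (LJ_delta k) (LJ_delta (k + 1)).

End Calculus.

Section LiePoisson.
Variables (R : realType) (g : vectType R) (br : g -> g -> g).
Variables (n : nat) (e : n.-tuple g).

Definition struct_const (i j k : 'I_n) : R := coord e k (br e`_i e`_j).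

Definition lie_poisson : ext e :=
  2^-1 *: \sum_i \sum_j \sum_k
    struct_const i j k *: fmul (ceval e e`_k) (wedge (gen e i) (gen e j)).

End LiePoisson.

(* Main.v *)
(* Contraction with the volume form dx_1 /\ ... /\ dx_n gives an isomorphism
   "star" between p-vector fields and (n - p)-forms on g^*.  It exchanges exterior
   multiplications with contractions, hence turns i(Lambda) on forms into
   - Lambda /\ . on multivectors, and d into the divergence operator
   div = sum_i i(dx_i) o d/dx_i.  Since Lambda has even degree,
   [Lambda, Y] = div (Lambda /\ Y) - Lambda /\ div Y - (div Lambda) /\ Y.
   For the Lie-Poisson bivector, div Lambda is the modular vector field
   xi |-> trace (ad xi) up to sign; when it vanishes, star intertwines the Koszul
   differential i(Lambda) d - d i(Lambda) with [Lambda, .], and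
   (alpha, beta) |-> ((-1)^k star beta, star alpha) is an isomorphism from the
   LJ-homology complex onto the LJ-cohomology complex. *)

From HB Require Import structures.
Require Import Defs.
From mathcomp Require Import all_boot all_order all_algebra.
From mathcomp Require Import all_classical all_reals all_analysis.
From mathcomp Require Import fintype finset.
Require Import Defs.

Set Implicit Arguments.
Unset Strict Implicit.
Unset Printing Implicit Defensive.

Import Order.TTheory GRing.Theory Num.Theory.
Local Open Scope ring_scope.

(** * Isomorphisms of homology *)

Lemma lquot_first_iso (R : pzRingType) (V U : lmodType R) (B : submodClosed V)
    (F : {linear V -> U}) :
  (forall u, exists v, F v = u) -> (forall v, F v = 0 <-> v \in B) ->
  lmod_iso (lquot B) U.
Proof.
move=> F_surj F_ker.
(* [f] evaluates [F] at a chosen representative; [fE] shows that the choice is immaterial. *)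
pose f (q : lquot B) := F (projT1 (cid (lquot_piP q))).
have fE v : f (lquot_pi B v) = F v.
  rewrite /f; case: cid => u /= /esym /eq_lquot_pi /F_ker.
  by rewrite linearB => /eqP; rewrite subr_eq0 => /eqP.
have f_lin : linear f.
  move=> a p q; have [[u ->] [v ->]] := (lquot_piP p, lquot_piP q).
  rewrite -[a *: lquot_pi B u]lquot_piZ -lquot_piD !fE; exact: linearP.
pose fl := GRing.isLinear.Build R (lquot B) U *:%R f f_lin.
pose f' : {linear lquot B -> U} := HB.pack f fl.
exists f'; have [h hE] := choice F_surj.
exists (fun u => lquot_pi B (h u)) => [q|u]; rewrite /f' /=.
  have [v ->] := lquot_piP q; rewrite fE.
  by apply/eq_lquot_pi/F_ker; rewrite linearB hE subrr.
by rewrite fE hE.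
Qed.

(** Three maps are kept apart because the intended isomorphism carries a sign depending on the
    degree. [phi] matches chains, [phi'] matches the sources of boundaries, and injectivity of [psi]
    suffices to compare cycle conditions. *)
Lemma homology_iso (R : pzRingType) (W W2 : lmodType R)
    (C C' : submodClosed W) (D D' : submodClosed W2)
    (d d' : {linear W -> W}) (t t' : {linear W2 -> W2})
    (phi phi' psi : {linear W -> W2}) :
  bijective phi -> bijective phi' -> injective psi ->
  (forall x, (phi x \in D) = (x \in C)) ->
  (forall x, (phi' x \in D') = (x \in C')) ->
  (forall x, t (phi x) = psi (d x)) -> (forall x, t' (phi' x) = phi (d' x)) ->
  lmod_iso (homology C C' d d') (homology D D' t t').
Proof.
move=> [phi1 phiK phi1K] [phi1' phiK' phi1K'] psi_inj phiC phiC' tphi t'phi.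
have psi0 x : (psi x == 0) = (x == 0).
  by rewrite -(inj_eq psi_inj) linear0.
have phi_cycle (z : cycle C d) : phi (val z) \in is_cycle D t.
  by have := valP z; rewrite /is_cycle !inE phiC tphi psi0.
pose f z := lquot_pi (@is_boundary _ _ D D' t t') (Cycle (phi_cycle z)).
have f_lin : linear f.
  move=> a x y; rewrite /f -[a *: lquot_pi _ _]lquot_piZ -lquot_piD.
  by congr lquot_pi; apply: val_inj; rewrite /= linearP.
pose F : {linear cycle C d -> homology D D' t t'} :=
  HB.pack f (GRing.isLinear.Build R _ _ *:%R f f_lin).
apply: (lquot_first_iso (F := F)) => [q|z].
  have [z ->] := lquot_piP q.
  have zP : phi1 (val z) \in is_cycle C d.
    by have := valP z; rewrite /is_cycle !inE -phiC -psi0 -tphi phi1K.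
  exists (Cycle zP); rewrite /F /= /f; congr lquot_pi; apply: val_inj => /=.
  exact: phi1K.
(* Writing 0 as [F 0] turns the kernel condition into an equality of two classes, as [eq_lquot_pi]
   requires. *)
rewrite /F /= /f -(linear0 F) /F /= /f.
have memB : (z \in @is_boundary _ _ C C' d d') =
    (Cycle (phi_cycle z) \in @is_boundary _ _ D D' t t').
  apply/asboolP/asboolP => /= -[y Cy yz].
    by exists (phi' y); rewrite ?phiC' // t'phi yz.
  exists (phi1' y); first by rewrite -phiC' phi1K'.
  by apply: (can_inj phiK); rewrite -t'phi phi1K'.
have cycleB0 : Cycle (phi_cycle z) - Cycle (phi_cycle 0) = Cycle (phi_cycle z).
  by apply: val_inj; rewrite /= linear0 subr0.
by rewrite memB -[in _ \in _]cycleB0; exact: eq_lquot_pi.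
Qed.

(** * Exterior algebra and the star operator *)

Section ExteriorAlgebra.
Variables (R : realType) (g : vectType R) (n : nat) (e : n.-tuple g).
Local Notation A := (cinfty e).
Implicit Types (f h : A) (P Q : ext e) (i j : 'I_n) (S T U : {set 'I_n}).

Local Notation below i S := #|[pred j in S | (j < i)%N]|.

(** * Sign exponents and exterior multiplication by a generator *)

Lemma card_belowE i S : below i S = (\sum_(j in S) (j < i))%N.
Proof. by rewrite -sum1_card big_mkcondr. Qed.

Lemma card_belowU1 i j S : j \notin S -> below i (j |: S) = ((j < i) + below i S)%N.
Proof. by move=> jS; rewrite !card_belowE big_setU1. Qed.

Lemma inversionsE S T : inversions S T = (\sum_(i in S) below i T)%N.
Proof.
rewrite /inversions -sum1_card (eq_bigl (fun p : 'I_n * 'I_n =>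
  (p.1 \in S) && ((p.2 \in T) && (p.2 < p.1)%N))) //.
rewrite -(pair_big_dep _ (fun i j => (j \in T) && (j < i)%N) (fun _ _ => 1%N)) /=.
by apply: eq_bigr => i _; rewrite sum1_card.
Qed.

Lemma inversionsU1 i S T : i \notin S ->
  inversions (i |: S) T = (below i T + inversions S T)%N.
Proof. by move=> iS; rewrite !inversionsE big_setU1. Qed.

(** Only the splitting with S = {i} contributes; this closed form carries the later sign
    computations. *)
Lemma wedge_gen i P : wedge (gen e i) P = [ffun U : {set 'I_n} =>
  if i \in U then (-1) ^+ below i U * P (U :\ i) else 0].
Proof.
apply/ffunP => U; rewrite !ffunE; case: ifP => iU.
  rewrite (bigD1 [set i]) ?powersetE ?sub1set //= big1 ?addr0 => [|S /andP[_ /negPf Si]].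
    rewrite ffunE eqxx mul1r inversionsE big_set1; congr ((-1) ^+ _ * _).
    by apply: eq_card => j; rewrite !inE; case: eqVneq => //= ->; rewrite ltnn andbF.
  by rewrite ffunE Si mul0r mulr0.
rewrite big1 // => S; rewrite powersetE ffunE => SU.
case: eqP => [Si|]; last by rewrite mul0r mulr0.
by move: SU; rewrite Si sub1set iU.
Qed.

(** The subsets of U containing i are the sets [i |: S] with S in [U :\ i]; the signs match because
    the elements of U below i split between [i |: S] and the rest. *)
Lemma wedge_genA i P Q : wedge (wedge (gen e i) P) Q = wedge (gen e i) (wedge P Q).
Proof.
rewrite !wedge_gen; apply/ffunP => U; rewrite !ffunE.
rewrite (bigID (fun S : {set 'I_n} => i \in S)) /= addrC big1 ?add0r => [|S]; last first.
  by case/andP=> _ /negPf iS; rewrite ffunE iS mul0r mulr0.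
case: ifP => iU; last first.
  rewrite big1 // => S /andP[]; rewrite powersetE => /subsetP SU /SU.
  by rewrite iU.
rewrite mulr_sumr (reindex_onto (fun S => i |: S) (fun S => S :\ i)) /=; last first.
  by move=> S /andP[_ iS]; rewrite setD1K.
apply: eq_big => [S|S /andP[/andP[iSU _] /eqP iS]].
  rewrite !powersetE setU11 andbT subUset sub1set iU /= subsetD1; congr (_ && _).
  apply/eqP/idP => [<-|iS]; first by rewrite !inE eqxx.
  by rewrite setU1K.
have {}iS : i \notin S by rewrite -iS !inE eqxx.
rewrite ffunE setU11 setU1K // inversionsU1 // !mulrA -!exprD setDDl.
have iSU' : i |: S \subset U by rewrite -powersetE.
have -> : below i U = (below i (i |: S) + below i (U :\: (i |: S)))%N.
  by rewrite !card_belowE (big_setID (i |: S)) /= (setIidPr iSU').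
by congr (_ ^+ _ * _ * _); rewrite addnC addnA.
Qed.

(** * Linearity of products in their left argument *)

Lemma wedgeDl P1 P2 Q : wedge (P1 + P2) Q = wedge P1 Q + wedge P2 Q.
Proof.
apply/ffunP => U; rewrite !ffunE -big_split /=; apply: eq_bigr => S _.
by rewrite ffunE mulrDl mulrDr.
Qed.

Lemma wedge0l Q : wedge 0 Q = 0.
Proof. by apply/ffunP => U; rewrite !ffunE big1 // => S _; rewrite ffunE mul0r mulr0. Qed.

Lemma wedge_suml I (r : seq I) (F : I -> ext e) Q :
  wedge (\sum_(k <- r) F k) Q = \sum_(k <- r) wedge (F k) Q.
Proof. by elim/big_rec2: _ => [|k _ P _ <-]; rewrite ?wedge0l ?wedgeDl. Qed.

Lemma wedgeZl (a : R) P Q : wedge (a *: P) Q = a *: wedge P Q.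
Proof.
apply/ffunP => U; rewrite !ffunE scaler_sumr; apply: eq_bigr => S _.
by rewrite ffunE -cinfty_scaleAl -cinfty_scaleAr.
Qed.

Lemma wedgeNl P Q : wedge (- P) Q = - wedge P Q.
Proof. by rewrite -scaleN1r wedgeZl scaleN1r. Qed.

Lemma wedge_fmull f P Q : wedge (fmul f P) Q = fmul f (wedge P Q).
Proof.
apply/ffunP => U; rewrite !ffunE mulr_sumr; apply: eq_bigr => S _.
by rewrite ffunE -mulrA mulrCA.
Qed.

Lemma contract_fmul i f P : contract i (fmul f P) = fmul f (contract i P).
Proof. by apply/ffunP => S; rewrite !ffunE; case: ifP => _; rewrite ?mulr0 // mulrCA. Qed.

Lemma fmulDl f h P : fmul (f + h) P = fmul f P + fmul h P.
Proof. by apply/ffunP => S; rewrite !ffunE mulrDl. Qed.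

Lemma fmul0l P : fmul 0 P = 0.
Proof. by apply/ffunP => S; rewrite !ffunE mul0r. Qed.

Lemma fmul_suml I (r : seq I) (F : I -> A) P :
  fmul (\sum_(k <- r) F k) P = \sum_(k <- r) fmul (F k) P.
Proof. by elim/big_rec2: _ => [|k _ Q _ <-]; rewrite ?fmul0l ?fmulDl. Qed.

Lemma fmulZl (a : R) f P : fmul (a *: f) P = a *: fmul f P.
Proof. by apply/ffunP => S; rewrite !ffunE cinfty_scaleAl. Qed.

Lemma fmulNl f P : fmul (- f) P = - fmul f P.
Proof. by rewrite -scaleN1r fmulZl scaleN1r. Qed.

(** The constant function 1, unit of [wedge]. Writing a generator as [wedge (gen e i) ext1] lets the
    rules for [wedge (gen e i) P] apply to it. *)
Definition ext1 : ext e := [ffun S : {set 'I_n} => (S == set0)%:R].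

Lemma wedge_gen_ext1 i : wedge (gen e i) ext1 = gen e i.
Proof.
rewrite wedge_gen; apply/ffunP => U; rewrite !ffunE.
case: ifP => iU; last by case: eqP iU => // ->; rewrite set11.
have -> : (U :\ i == set0) = (U == [set i]).
  by rewrite setD_eq0 subset1; case: (U =P set0) iU => [->|]; rewrite ?inE ?orbF.
case: eqP => [->|]; last by rewrite mulr0.
by rewrite card_belowE big_set1 ltnn mulr1.
Qed.

Lemma wedge_ext1 P : wedge ext1 P = P.
Proof.
apply/ffunP => U; rewrite ffunE (bigD1 set0) ?powersetE ?sub0set //= big1.
  by rewrite ffunE eqxx inversionsE big_set0 mul1r mul1r addr0 setD0.
by move=> S /andP[_ /negPf S0]; rewrite ffunE S0 mul0r mulr0.
Qed.

Lemma contract_ext1 i : contract i ext1 = 0.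
Proof.
apply/ffunP => S; rewrite !ffunE; case: ifP => // _.
have /negPf -> : i |: S != set0 by apply/set0Pn; exists i; rewrite setU11.
by rewrite mulr0.
Qed.

(** * Relations between contractions and exterior multiplications *)

Lemma ltn_ord_exclusive i j : i != j -> (i < j)%N = ~~ (j < i)%N.
Proof. by move=> ij; rewrite -leqNgt ltn_neqAle; rewrite -val_eqE in ij; rewrite ij. Qed.

(** For distinct indices exactly one of i < j and j < i holds, so the two sign exponents differ by
    one. *)
Lemma contractC i j P : contract i (contract j P) = - contract j (contract i P).
Proof.
apply/ffunP => S; rewrite !ffunE !inE.
case: (eqVneq i j) => [<-|ij] /=; first by rewrite mulr0 if_same oppr0.
case: ifPn => iS; case: ifPn => jS; rewrite ?mulr0 ?oppr0 //.
rewrite !card_belowU1 // setUCA (ltn_ord_exclusive ij).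
rewrite !mulrA -!exprD -mulNr; congr (_ * _).
by case: (j < i)%N => /=; rewrite ?add0n ?add1n ?addnS ?addSn exprS mulN1r ?opprK addnC.
Qed.

Lemma contractK i P : contract i (contract i P) = 0.
Proof. by apply/ffunP => S; rewrite !ffunE setU11 mulr0 if_same. Qed.

(** This is the canonical anticommutation relation; the contraction rules for bivectors below follow
    from it. *)
Lemma contract_wedge_gen i j P : contract i (wedge (gen e j) P) =
  (if i == j then P else 0) - wedge (gen e j) (contract i P).
Proof.
rewrite !wedge_gen; apply/ffunP => S; rewrite !ffunE !inE.
case: (eqVneq i j) => [<-|ij] /=.
  case: ifPn => iS.
    rewrite setD1K // mulrA -exprD.
    have -> : below i (S :\ i) = below i S.
      by rewrite !card_belowE [in RHS](big_setD1 _ iS) /= ltnn.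
    by rewrite addnn -muln2 exprM sqrr_sign mul1r subrr.
  rewrite card_belowU1 // ltnn setU1K // mulrA -exprD.
  by rewrite addnn -muln2 exprM sqrr_sign mul1r subr0.
rewrite ffunE add0r; case: ifPn => iS /=; case: ifPn => jS /=; rewrite ?mulr0 ?oppr0 //.
have -> : below i S = ((j < i) + below i (S :\ j))%N.
  by rewrite -{1}(setD1K jS) card_belowU1 // !inE eqxx.
have -> : (i |: S) :\ j = i |: (S :\ j).
  by apply/setP => k; rewrite !inE; case: (eqVneq k i) => // ->; rewrite ij.
rewrite card_belowU1 // !mulrA -!exprD -mulNr (ltn_ord_exclusive ij); congr (_ * _).
by case: (j < i)%N => /=; rewrite ?add0n ?add1n ?addnS ?addSn exprS mulN1r ?opprK addnC.
Qed.

Lemma contract_gen i j : contract i (gen e j) = if i == j then ext1 else 0.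
Proof. by rewrite -[gen e j]wedge_gen_ext1 contract_wedge_gen contract_ext1 linear0 subr0. Qed.

(** * Partial derivatives of coefficients *)

Lemma cpartialM i f h : cpartial i (f * h) = cpartial i f * h + f * cpartial i h.
Proof.
apply: val_inj => /=; rewrite partialM; last 2 first.
- by apply: smooth_derivable; exact: valP.
- by apply: smooth_derivable; exact: valP.
by rewrite addrC [X in X + _]mulrC.
Qed.

Lemma cpartial1 i : cpartial i 1 = 0 :> A.
Proof.
apply: (addrI (cpartial i (1 : A))); rewrite addr0.
by rewrite -[in RHS](mulr1 1) cpartialM mulr1 mul1r.
Qed.

Lemma coef_partial_fmul i f P :
  coef_partial i (fmul f P) = fmul (cpartial i f) P + fmul f (coef_partial i P).
Proof. by apply/ffunP => S; rewrite !ffunE cpartialM. Qed.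

Lemma coef_partial_wedge_gen i j P :
  coef_partial i (wedge (gen e j) P) = wedge (gen e j) (coef_partial i P).
Proof.
rewrite !wedge_gen; apply/ffunP => S; rewrite !ffunE.
by case: ifP => _; rewrite ?linear0 // -signr_odd !mulr_sign; case: ifP; rewrite ?linearN.
Qed.

Lemma coef_partial_ext1 i : coef_partial i ext1 = 0.
Proof. by apply/ffunP => S; rewrite !ffunE; case: eqP => _; rewrite ?cpartial1 ?linear0. Qed.

Lemma coef_partial_gen i j : coef_partial i (gen e j) = 0.
Proof. by rewrite -wedge_gen_ext1 coef_partial_wedge_gen coef_partial_ext1 linear0. Qed.

Lemma coef_partial_wedge i P Q : coef_partial i (wedge P Q) =
  wedge (coef_partial i P) Q + wedge P (coef_partial i Q).
Proof.
apply/ffunP => U; rewrite !ffunE linear_sum -big_split; apply: eq_bigr => S _.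
rewrite /= !ffunE -mulrDr -cpartialM -signr_odd !mulr_sign.
by case: ifP; rewrite ?linearN.
Qed.

(* The sign is the one for which [star] exchanges exterior multiplication by
   [gen e i] and contraction by [i] exactly, for every i and in every degree. *)
Definition star P : ext e :=
  [ffun S : {set 'I_n} => (-1) ^+ (\sum_(i in S) i) * P (~: S)].

Fact star_linear : linear star.
Proof.
move=> a P Q; apply/ffunP => S; rewrite !ffunE mulrDr.
by congr (_ + _); rewrite cinfty_scaleAr.
Qed.

HB.instance Definition _ :=
  GRing.isLinear.Build R (ext e) (ext e) *:%R star star_linear.

Lemma star_bij : bijective star.
Proof.
exists (fun P => [ffun S : {set 'I_n} => (-1) ^+ (\sum_(i in ~: S) i) * P (~: S)] : ext e);
  move=> P; apply/ffunP => S; rewrite !ffunE setCK mulrA -exprD;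
  by rewrite addnn -muln2 exprM sqrr_sign mul1r.
Qed.

Lemma star_homog k P : (star P \in homog k) = (P \in homog (n%:Z - k)).
Proof.
have cardC S : (#|~: S|%:Z == k) = (#|S|%:Z == n%:Z - k).
  have -> : n%:Z = #|S|%:Z + #|~: S|%:Z by rewrite -PoszD cardsC card_ord.
  by rewrite -addrA -{1}[#|S|%:Z]addr0 (inj_eq (addrI _)) [RHS]eq_sym subr_eq0.
have sign0 m h : ((-1) ^+ m * h != 0) = (h != 0).
  by rewrite -signr_odd mulr_sign; case: ifP; rewrite ?oppr_eq0.
apply/forallP/forallP => H S; have := H (~: S); rewrite ffunE !sign0.
  by rewrite setCK cardC.
by rewrite -cardC setCK.
Qed.

Lemma star_fmul f P : star (fmul f P) = fmul f (star P).
Proof. by apply/ffunP => S; rewrite !ffunE mulrCA. Qed.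

Lemma star_coef_partial i P : star (coef_partial i P) = coef_partial i (star P).
Proof.
apply/ffunP => S; rewrite !ffunE -signr_odd !mulr_sign.
by case: ifP; rewrite ?linearN.
Qed.

(** This explains the sign of [star]: adding i to S adds i to the exponent, which has the parity of
    the two counts together and so trades the sign of a wedge for that of a contraction. *)
Lemma card_belowC i S : (below i S + below i (~: S))%N = i.
Proof.
transitivity (\sum_(j < n) (j < i))%N.
  rewrite !card_belowE [RHS](bigID [in S]) /=; congr (_ + _)%N.
  by apply: eq_bigl => j; rewrite inE.
by rewrite -big_mkcond /= (big_ord_narrow (ltnW (ltn_ord i))) sum1_card card_ord.
Qed.

Lemma odd_ord_belowC i S : odd i = odd (below i S) (+) odd (below i (~: S)).
Proof. by rewrite -oddD card_belowC. Qed.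

Lemma star_wedge_gen i P : star (wedge (gen e i) P) = contract i (star P).
Proof.
rewrite wedge_gen; apply/ffunP => S; rewrite !ffunE inE.
case: ifPn => iS /=; last by rewrite ?negbK in iS; rewrite iS mulr0.
rewrite (negPf iS) big_setU1 //= setCU setIC -setDE !mulrA -!exprD; congr (_ * _).
rewrite -signr_odd -[RHS]signr_odd !oddD (odd_ord_belowC i S).
by case: (odd _); case: (odd _); case: (odd _).
Qed.

Lemma star_contract i P : star (contract i P) = wedge (gen e i) (star P).
Proof.
rewrite wedge_gen; apply/ffunP => S; rewrite !ffunE inE.
case: (boolP (i \in S)) => iS /=; last by rewrite mulr0.
rewrite (big_setD1 _ iS) /= setCD setUC !mulrA -!exprD; congr (_ * _).
rewrite -signr_odd -[RHS]signr_odd !oddD (odd_ord_belowC i S).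
by case: (odd _); case: (odd _); case: (odd _).
Qed.

Lemma star_ext_d P : star (ext_d P) = \sum_i contract i (coef_partial i (star P)).
Proof.
rewrite linear_sum; apply: eq_bigr => i _ /=.
by rewrite star_wedge_gen star_coef_partial.
Qed.

(** * Divergence-free bivector fields *)

(** The normalisation is that of the Lie-Poisson 2-vector; for antisymmetric [p], the coefficient at
    a < b is [p a b]. *)
Definition bivector (p : 'I_n -> 'I_n -> A) : ext e :=
  2^-1 *: \sum_a \sum_b fmul (p a b) (wedge (gen e a) (gen e b)).

Lemma coef_partial_bivector i p :
  coef_partial i (bivector p) = bivector (fun a b => cpartial i (p a b)).
Proof.
rewrite /bivector linearZ linear_sum; congr (_ *: _); apply: eq_bigr => a _.
rewrite linear_sum; apply: eq_bigr => b _ /=.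
rewrite coef_partial_fmul coef_partial_wedge_gen coef_partial_gen.
by rewrite linear0 [X in _ + X]linear0 addr0.
Qed.

Lemma wedge_bivector p Q : wedge (bivector p) Q =
  2^-1 *: \sum_a \sum_b fmul (p a b) (wedge (gen e a) (wedge (gen e b) Q)).
Proof.
rewrite wedgeZl wedge_suml; congr (_ *: _); apply: eq_bigr => a _.
rewrite wedge_suml; apply: eq_bigr => b _.
by rewrite wedge_fmull wedge_genA.
Qed.

Lemma bivector_homog p : bivector p \in homog 2%:Z.
Proof.
apply: rpredZ; apply: rpred_sum => a _; apply: rpred_sum => b _.
apply/forallP => S; apply/implyP; rewrite wedge_gen !ffunE.
case: ifP => aS; last by rewrite mulr0 eqxx.
case: (S :\ a =P [set b]) => [Sab _|_]; last by rewrite /= !mulr0 eqxx.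
by rewrite (cardsD1 a) aS Sab cards1.
Qed.

Lemma grading_bivector p : grading (bivector p) = bivector p.
Proof.
apply/ffunP => S; rewrite ffunE.
have /forallP/(_ S)/implyP := bivector_homog p.
case: (eqVneq (bivector p S) 0) => [->|_ /(_ isT)/eqP[->]]; first by rewrite mulr0.
by rewrite sqrrN expr1n mul1r.
Qed.

(** Contraction is a graded derivation: moving it past two generators changes the sign twice, so no
    sign remains. *)
Lemma contract_wedge_bivector p i Q : contract i (wedge (bivector p) Q) =
  wedge (contract i (bivector p)) Q + wedge (bivector p) (contract i Q).
Proof.
have contractE : contract i (bivector p) = 2^-1 *: \sum_a \sum_b
    fmul (p a b) (contract i (wedge (gen e a) (gen e b))).
  rewrite /bivector linearZ linear_sum; congr (_ *: _); apply: eq_bigr => a _.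
  by rewrite linear_sum; apply: eq_bigr => b _; exact: contract_fmul.
rewrite contractE !wedge_bivector wedgeZl wedge_suml linearZ linear_sum /=.
rewrite -scalerDr -big_split; congr (_ *: _); apply: eq_bigr => a _ /=.
rewrite wedge_suml linear_sum -big_split; apply: eq_bigr => b _ /=.
rewrite wedge_fmull contract_fmul -[RHS]linearD /=; congr (fmul _ _).
rewrite !contract_wedge_gen.
rewrite contract_gen wedgeDl wedgeNl wedge_genA -addrA.
congr (_ + _); first by case: eqP; rewrite ?wedge0l.
by rewrite linearB /= opprB addrC; congr (_ - _); case: eqP; rewrite ?wedge_ext1 ?wedge0l.
Qed.

(** Reconciles the sum over i < j in [contract2] with the halved full sum in [bivector]. *)
Lemma sum_ltn_ord_sym (F : 'I_n -> 'I_n -> ext e) :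
  (forall i, F i i = 0) -> (forall i j, F i j = F j i) ->
  \sum_(i < n) \sum_(j < n | (i < j)%N) F i j = 2^-1 *: \sum_i \sum_j F i j.
Proof.
move=> F0 FC; pose G := \sum_(i < n) \sum_(j < n | (i < j)%N) F i j.
have -> : \sum_i \sum_j F i j = G + G.
  (* The second copy of [G] is transposed to supply the pairs below the diagonal. *)
  rewrite {2}/G [X in _ = _ + X](exchange_big_dep xpredT) //= -big_split /=.
  apply: eq_bigr => i _; rewrite (bigD1 i) //= F0 add0r (bigID (fun j : 'I_n => (i < j)%N)) /=.
  congr (_ + _); first apply: eq_bigl => j.
    by rewrite -val_eqE neq_ltn /=; case: ltngtP.
  apply: eq_big => [j|j _]; last exact: FC.
  by rewrite -leqNgt [RHS]ltn_neqAle.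
by rewrite -mulr2n -(scaler_nat 2 G) scalerA mulVf ?pnatr_eq0 // scale1r.
Qed.

(** Contracting the first or the second generator gives the same sum by antisymmetry, which cancels
    the factor 1/2. *)
Lemma contract_bivector p i : (forall a b, p a b = - p b a) ->
  contract i (bivector p) = \sum_b fmul (p i b) (gen e b).
Proof.
move=> pN.
have sum1 a : \sum_b contract i (fmul (p a b) (wedge (gen e a) (gen e b))) =
  (if a == i then \sum_b fmul (p a b) (gen e b) else 0) + fmul (p i a) (gen e a).
  transitivity (\sum_b ((if a == i then fmul (p a b) (gen e b) else 0)
      + if b == i then fmul (p i a) (gen e a) else 0)).
    apply: eq_bigr => b _; rewrite contract_fmul contract_wedge_gen linearB /=.
    congr (_ + _); first by rewrite eq_sym; case: eqP; rewrite ?linear0.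
    rewrite contract_gen eq_sym; case: eqP => [->|_]; last by rewrite !linear0 ?oppr0.
    by rewrite wedge_gen_ext1 pN fmulNl opprK.
  rewrite big_split /= -[X in _ + X]big_mkcond big_pred1_eq; congr (_ + _).
  by case: eqP => // _; rewrite big1.
rewrite /bivector linearZ linear_sum /=.
under eq_bigr do rewrite linear_sum /= sum1.
rewrite big_split /= -big_mkcond big_pred1_eq -mulr2n -(scaler_nat 2 (\sum_b _)) scalerA.
by rewrite mulVf ?pnatr_eq0 // scale1r.
Qed.

Section DivergenceFree.
Variable p : 'I_n -> 'I_n -> A.
Hypothesis pN : forall a b, p a b = - p b a.

(** Read off at {j} from the contraction by i, whose sign is trivial there since no element of {j}
    lies below i. *)
Lemma bivector_coef i j : (i < j)%N -> bivector p [set i; j] = p i j.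
Proof.
move=> ij; have := congr1 (fun P : ext e => P [set j]) (contract_bivector i pN).
have ij' : i != j by rewrite -val_eqE neq_ltn ij.
rewrite /= !ffunE inE (negPf ij') card_belowE big_set1 ltnNge (ltnW ij) mul1r => ->.
rewrite sum_ffunE (bigD1 j) //= !ffunE eqxx mulr1 big1 ?addr0 // => k kj.
by rewrite !ffunE (inj_eq set1_inj) eq_sym (negPf kj) mulr0.
Qed.

Lemma contract2_bivector P : contract2 (bivector p) P =
  2^-1 *: \sum_a \sum_b fmul (p a b) (contract b (contract a P)).
Proof.
rewrite -sum_ltn_ord_sym => [|i|i j].
- by apply: eq_bigr => i _; apply: eq_bigr => j ij; rewrite bivector_coef.
- by rewrite contractK linear0.
- by rewrite contractC linearN /= (pN i) fmulNl opprK.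
Qed.

(** The minus sign arises because [contract b (contract a P)] becomes a wedge with generator b
    before a, and swapping the summation indices uses p b a = - p a b. *)
Lemma star_contract2_bivector P :
  star (contract2 (bivector p) P) = - wedge (bivector p) (star P).
Proof.
rewrite contract2_bivector wedge_bivector linearZ linear_sum /= -scalerN; congr (_ *: _).
rewrite exchange_big -sumrN; apply: eq_bigr => a _ /=.
rewrite linear_sum -sumrN; apply: eq_bigr => b _ /=.
by rewrite star_fmul !star_contract (pN b) fmulNl opprK.
Qed.

Hypothesis p_div : forall b, \sum_a cpartial a (p a b) = 0.

Lemma divergence_bivector : \sum_i contract i (coef_partial i (bivector p)) = 0.
Proof.
transitivity (\sum_i \sum_b fmul (cpartial i (p i b)) (gen e b)).
  apply: eq_bigr => i _; rewrite coef_partial_bivector contract_bivector // => a b.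
  by rewrite pN linearN.
rewrite exchange_big big1 // => b _ /=.
by rewrite -fmul_suml p_div fmul0l.
Qed.

(* [\sum_i contract i (coef_partial i Y)] is the divergence of [Y]. *)
Lemma schouten_bivector Y : schouten (bivector p) Y =
  \sum_i contract i (coef_partial i (wedge (bivector p) Y))
  - wedge (bivector p) (\sum_i contract i (coef_partial i Y)).
Proof.
(* Expanding the divergence of the product yields one term absent from the bracket, the divergence
   of the bivector wedged with [Y]; this term vanishes. *)
have div0 : \sum_i wedge (contract i (coef_partial i (bivector p))) Y = 0.
  by rewrite -wedge_suml divergence_bivector wedge0l.
rewrite linear_sum -sumrB -[LHS]addr0 -[X in _ + X = _]div0.
rewrite /schouten grading_bivector -big_split.
apply: eq_bigr => i _ /=.
rewrite coef_partial_wedge linearD /= !coef_partial_bivector !contract_wedge_bivector.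
by rewrite addrA addrK [RHS]addrC [X in _ = _ + X]addrC addrA.
Qed.

(** The minus sign of [star_contract2_bivector] exchanges the roles of the two terms, giving the
    divergence formula for the bracket. *)
Lemma star_koszul_bivector P :
  star (contract2 (bivector p) (ext_d P) - ext_d (contract2 (bivector p) P))
  = schouten (bivector p) (star P).
Proof.
rewrite linearB /= star_contract2_bivector !star_ext_d star_contract2_bivector.
rewrite schouten_bivector addrC; congr (_ - _).
rewrite -sumrN; apply: eq_bigr => i _.
by rewrite linearN [contract i _]linearN opprK.
Qed.

(* The degree-dependent sign absorbs the [(-1)^k] in [LJ_delta] and the sign in
   [star_contract2_bivector], so that [LJ_sigma_star] holds on the nose. *)
Definition LJ_star (k : int) (z : ext e * ext e) : ext e * ext e :=
  ((-1) ^ k *: star z.2, star z.1).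

Fact LJ_star_linear k : linear (LJ_star k).
Proof.
move=> a y z; congr pair => /=; rewrite linearP //.
by rewrite scalerDr !scalerA mulrC.
Qed.

HB.instance Definition _ k :=
  GRing.isLinear.Build R (ext e * ext e)%type (ext e * ext e)%type *:%R
    (LJ_star k) (LJ_star_linear k).

Lemma signz_sqr k : (-1) ^ k * (-1) ^ k = 1 :> R.
Proof. by rewrite -expfzMl mulrNN mulr1 exp1rz. Qed.

Lemma LJ_star_bij k : bijective (LJ_star k).
Proof.
have [f fK starK] := star_bij.
exists (fun z => (f z.2, f ((-1) ^ k *: z.1))) => -[P Q] /=; rewrite /LJ_star /=.
  by rewrite fK scalerA signz_sqr scale1r fK.
by rewrite starK scalerA signz_sqr scale1r starK.
Qed.

(** Degrees k and k - 1 go to n - k and n - k + 1, which is why [LJ_star] swaps the components. *)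
Lemma LJ_star_chain k z :
  (LJ_star k z \in LJ_chain (n%:Z - k + 1)) = (z \in LJ_chain k).
Proof.
have signz_homog l P : ((-1) ^ k *: P \in homog l) = (P \in homog l).
  apply/idP/idP => [/(rpredZ ((-1) ^ k))|]; last exact: rpredZ.
  by rewrite scalerA signz_sqr scale1r.
rewrite -[LHS]/(_ && _) -[RHS]/(_ && _) signz_homog !star_homog andbC addrK.
by rewrite !opprD opprK -!addrA !addrA subrr add0r.
Qed.

Lemma LJ_sigma_star k z :
  LJ_sigma (bivector p) (LJ_star k z) = LJ_star (k - 1) (LJ_delta (bivector p) k z).
Proof.
congr pair; rewrite /= ?star_koszul_bivector //.
rewrite [star (_ + _)]linearD /= [star (_ *: _)]linearZ /= star_koszul_bivector.
rewrite star_contract2_bivector [schouten _ _]linearZ /=.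
(* With (-1)^(k-1) = -(-1)^k, the sign in [LJ_delta] is squared away and the wedge term becomes
   positive. *)
rewrite expfzDr ?oppr_eq0 ?oner_eq0 // exprN1 invrN1 mulrN1.
by rewrite scalerDr !scaleNr !scalerN opprK scalerA signz_sqr scale1r.
Qed.

Lemma LJ_duality k :
  lmod_iso (LJ_homology (bivector p) k) (LJ_cohomology (bivector p) (n%:Z - k + 1)).
Proof.
apply: (homology_iso (phi := LJ_star k) (phi' := LJ_star (k + 1))
    (psi := LJ_star (k - 1))) => [|||z|z|z|z].
- exact: LJ_star_bij.
- exact: LJ_star_bij.
- exact: bij_inj (LJ_star_bij _).
- exact: LJ_star_chain.
(* Boundaries come from degree k + 1 in homology, hence from n - k in cohomology. *)
- have -> : n%:Z - k + 1 - 1 = n%:Z - (k + 1) + 1 by rewrite addrK opprD addrA subrK.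
  exact: LJ_star_chain.
- exact: LJ_sigma_star.
- by have := LJ_sigma_star (k + 1) z; rewrite addrK.
Qed.

End DivergenceFree.

End ExteriorAlgebra.

(** * Lie-Poisson structures of unimodular Lie algebras *)

Section LiePoissonUnimodular.
Variables (R : realType) (g : vectType R) (n : nat) (e : n.-tuple g).
Hypothesis e_basis : basis_of {:g} e.
Let e_free : free e := basis_free e_basis.

(** Basis independence of the trace: expand [vbasis] vectors in [e], exchange the sums, and contract
    the expansion in [vbasis]. *)
Lemma lfun_trace_basis (f : 'End(g)) : lfun_trace f = \sum_i coord e i (f e`_i).
Proof.
pose v := vbasis {:g}; have v_basis : basis_of {:g} v := vbasisP _.
transitivity (\sum_(j < \dim {:g}) coord v j (f v`_j)).
  by apply: eq_bigr => j _; rewrite /passmx.mxof !mxE passmx.vecof_delta.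
transitivity (\sum_(j < \dim {:g}) \sum_i coord e i v`_j * coord v j (f e`_i)).
  apply: eq_bigr => j _; rewrite {1}(coord_basis e_basis (memvf v`_j)) !linear_sum.
  by apply: eq_bigr => i _; rewrite !linearZ.
rewrite exchange_big; apply: eq_bigr => i _ /=.
rewrite [in RHS](coord_basis v_basis (memvf (f e`_i))) linear_sum.
by apply: eq_bigr => j _; rewrite linearZ mulrC.
Qed.

Lemma cpartial_ceval i u : cpartial i (ceval e u) = coord e i u *: (1 : cinfty e).
Proof.
apply: val_inj; apply/funext => x /=; rewrite /partial.
have -> : along e i x (fun y : dual g => y u : R) =
    cst (x u : R) + (coord e i u : R) *: id.
  apply/funext => t; rewrite /along add_lfunE scale_lfunE lfunE; congr (_ + _).
  exact: mulrC.
rewrite (deriveD (@derivable_cst _ _ _ _ _ _) (derivableZ (@derivable_id _ _ _ _))).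
by rewrite derive_cst (deriveZ _ (@derivable_id _ _ _ _)) derive_id add0r.
Qed.

Section LieBracket.
Variable br : g -> g -> g.
Hypothesis g_lie : lie_bracket br.

(** Polarisation of the alternating law at x + y. *)
Lemma lie_bracketN x y : br x y = - br y x.
Proof.
have [linl linr alt _] := g_lie.
have brD a b c : br (a + b) c = br a c + br b c by have := linl c 1 a b; rewrite !scale1r.
have brDr a b c : br c (a + b) = br c a + br c b by have := linr c 1 a b; rewrite !scale1r.
have := alt (x + y); rewrite brD !brDr !alt add0r addr0 => /eqP.
by rewrite addr_eq0 => /eqP.
Qed.

(** The Poisson bracket of the coordinate functions x_a and x_b. *)
Definition lie_poisson_coef (a b : 'I_n) : cinfty e :=
  \sum_k struct_const br e a b k *: ceval e e`_k.

Lemma lie_poissonE : lie_poisson br e = bivector lie_poisson_coef.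
Proof.
congr (_ *: _); apply: eq_bigr => a _; apply: eq_bigr => b _.
by rewrite fmul_suml; apply: eq_bigr => k _; rewrite fmulZl.
Qed.

Lemma struct_constN a b k : struct_const br e a b k = - struct_const br e b a k.
Proof. by rewrite /struct_const lie_bracketN linearN. Qed.

Lemma lie_poisson_coefN a b : lie_poisson_coef a b = - lie_poisson_coef b a.
Proof.
by rewrite -sumrN; apply: eq_bigr => k _; rewrite struct_constN scaleNr.
Qed.

Lemma cpartial_lie_poisson_coef i a b :
  cpartial i (lie_poisson_coef a b) = struct_const br e a b i *: (1 : cinfty e).
Proof.
rewrite linear_sum (bigD1 i) //= linearZ /= cpartial_ceval coord_free // eqxx scale1r.
rewrite big1 ?addr0 // => k ki.
rewrite linearZ /= cpartial_ceval coord_free //.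
by rewrite (negPf ki) scale0r scaler0.
Qed.

Lemma trace_adE (b : 'I_n) : lfun_trace (ad br e`_b) = \sum_a struct_const br e b a a.
Proof.
have [_ linr _ _] := g_lie.
(* [linfun] evaluates back to its argument once that argument is packed as a linear map. *)
pose f : {linear g -> g} := HB.pack (br e`_b) (GRing.isLinear.Build R g g *:%R _ (linr e`_b)).
rewrite lfun_trace_basis; apply: eq_bigr => a _.
by rewrite /ad (lfunE f).
Qed.

(** The coefficients are linear, so component b of the divergence is the constant - trace (ad
    e_b). *)
Lemma lie_poisson_divergence_free : unimodular br ->
  forall b, \sum_a cpartial a (lie_poisson_coef a b) = 0.
Proof.
move=> unim b; under eq_bigr do rewrite cpartial_lie_poisson_coef struct_constN.
by rewrite -scaler_suml sumrN -trace_adE unim oppr0 scale0r.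
Qed.

End LieBracket.
End LiePoissonUnimodular.

Theorem theorem4p12 (R : realType) (g : vectType R) (br : g -> g -> g)
    (g_lie : lie_bracket br) (g_unimodular : unimodular br)
    (n : nat) (e : n.-tuple g) (e_basis : basis_of {:g} e) (k : int) :
  lmod_iso (LJ_homology (lie_poisson br e) k)
           (LJ_cohomology (lie_poisson br e) (n%:Z - k + 1)).
Proof.
rewrite lie_poissonE; apply: LJ_duality.
  by move=> a b; exact: lie_poisson_coefN.
exact: lie_poisson_divergence_free.
Qed.
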